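(* The algorithm $\mathsf{Encode}$ described in the context is correct: given a $C_{ab}$ code $\mathcal{C}_H(\mathcal{P},m)\subseteq\mathbb{F}^n$ of dimension $k$, with $\mathcal{P}=\{P_1,\dots,P_n\}$ finite rational places, and a message $\mathbf{m}\in\mathbb{F}^k$, it outputs the codeword $\mathbf{c}=\phi(\mathbf{m})$, where $\phi:\mathbb{F}^k\to\mathcal{C}_H(\mathcal{P},m)$ is the encoding map defined in the context. It uses at most $$O\big(\mathsf{M}(m+an_X)\log(m+an_X)\big)\subset\tilde{O}(m+an_X)$$ operations in $\mathbb{F}$, where $n_X=n_X(\mathcal{P})$ and $a=\deg_Y(H)$.
   Context: Codes. Let $\mathbb{F}$ be a finite field and $a,b$ coprime positive integers, not both $1$. Let $\operatorname{supp}(H)$ be the set of monomials with non-zero coefficient in $H$. $H\in\mathbb{F}[X,Y]$ is a $C_{ab}$ polynomial if: (i) $X^b,Y^a\in\operatorname{supp}(H)$; (ii) $X^iY^j\in\operatorname{supp}(H)$ implies $ai+bj\le ab$; (iii) $\langle H,\partial H/\partial X,\partial H/\partial Y\rangle=\mathbb{F}[X,Y]$. Its function field $\mathbb{F}(x,y)$, with $H(x,y)=0$, has genus $g=(a-1)(b-1)/2$ and a rational place $P_\infty$ that is the only pole of $x$ and of $y$; $x^iy^j$ has pole order $ai+bj$ there. The other rational places (finite rational places) are identified with the points $(\alpha,\beta)\in\mathbb{F}^2$ with $H(\alpha,\beta)=0$. Each $f\in\mathbb{F}[x,y]$ has a unique expression with $y$-degree at most $a-1$, its standard form. The Riemann–Roch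 space $\mathcal{L}(mP_\infty)$ has basis $B=\{x^iy^j\mid ai+bj\le m,\ j\le a-1\}$. For distinct finite rational places $P_1,\dots,P_n$ and an integer $m\ge0$ (always assumed to satisfy $m\le n+2g-1$), $\mathcal{C}_H(\mathcal{P},m)=\{\operatorname{ev}_{\mathcal{P}}(f)\mid f\in\mathcal{L}(mP_\infty)\}$ with $\operatorname{ev}_{\mathcal{P}}(f)=(f(P_1),\dots,f(P_n))$. Encoding map. Let $k=\dim\mathcal{C}_H(\mathcal{P},m)$ and let $\hat B\subseteq B$ consist of $k$ monomials whose images under $\operatorname{ev}_{\mathcal{P}}$ are linearly independent ($\hat B=B$ if $k=|B|$). Then $\phi=\operatorname{ev}_{\mathcal{P}}\circ\varphi$, where $\varphi:\mathbb{F}^k\to\mathcal{L}(mP_\infty)$ takes the entries of $\mathbf{m}$ as coefficients of the monomials of $\hat B$ in some specified order. Point sets. For $\mathcal{P}\subseteq\mathbb{F}^2$, $\mathcal{X}(\mathcal{P})$ is the set of $X$-coordinates of points of $\mathcal{P}$, $n_X(\mathcal{P})=|\mathcal{X}(\mathcal{P})|$, and $\mathcal{Y}_\alpha(\mathcal{P})=\{\beta\mid(\alpha,\beta)\in\mathcal{P}\}$. Subroutine $\mathsf{UnivariateMPE}$: the classical fast multipoint evaluation algorithm; it inputs $h\in\mathbb{F}[Z]$ and $\mathcal{S}\subseteq\mathbb{F}$ and outputs the table $(h(\alpha))_{\alpha\in\mathcal{S}}$ in $O\big(\mathsf{M}(\deg h+|\mathcal{S}|)\log(\deg h+|\mathcal{S}|)\big)$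 operations. Subroutine $\mathsf{BivariateMPE}(f,\mathcal{P})$, for $f=\sum_{i=0}^{d_Y}f_i(X)Y^i\in\mathbb{F}[X,Y]$: compute $\mathcal{X}=\mathcal{X}(\mathcal{P})$ and $\mathcal{Y}_\alpha=\mathcal{Y}_\alpha(\mathcal{P})$; for $i=0,\dots,d_Y$ compute $\mathcal{F}_i=\mathsf{UnivariateMPE}(f_i,\mathcal{X})$; for each $\alpha\in\mathcal{X}$ form $g_\alpha=\sum_{i=0}^{d_Y}\mathcal{F}_i[\alpha]Y^i$ and compute $\mathcal{G}_\alpha=\mathsf{UnivariateMPE}(g_\alpha,\mathcal{Y}_\alpha)$; return $(\mathcal{G}_\alpha[\beta])_{(\alpha,\beta)\in\mathcal{P}}$. Algorithm $\mathsf{Encode}$. Input: $\mathcal{C}_H(\mathcal{P},m)$ and $\mathbf{m}\in\mathbb{F}^k$. 1. $f\leftarrow\varphi(\mathbf{m})\in\mathbb{F}[x,y]$ in standard form. 2. $\mathcal{F}\leftarrow\mathsf{BivariateMPE}(f,\mathcal{P})\in\mathbb{F}^{\mathcal{P}}$, where $f$ is lifted to $\mathbb{F}[X,Y]$ via its standard form. 3. Return $(\mathcal{F}[P_1],\dots,\mathcal{F}[P_n])\in\mathbb{F}^n$. Complexity counts basic arithmetic operations in $\mathbb{F}$ on an algebraic RAM model (table retrieval and insertion cost $O(1)$). $\mathsf{M}(n)$ is the cost of multiplying two univariate polynomials in $\mathbb{F}[X]$ of degree at most $n$; one can take $\mathsf{M}(n)\in O(n\log n\log\log n)\subset\tilde{O}(n)$.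 Here $\tilde{O}(h)=\bigcup_{c\ge0}O(h\log^c h)$.
   Formalization: The multiplication cost M is additionally assumed to be at least 1, superadditive and to satisfy M(2n) = O(M(n)), the usual regularity of multiplication times; for an irregular M, such as one with long plateaus, the stated bound can fail. *)

(* Defs.v *)
From HB Require Import structures.
From mathcomp Require Import all_boot all_order all_algebra.
From mathcomp Require Import reals exp.

Set Implicit Arguments.
Unset Strict Implicit.
Unset Printing Implicit Defensive.

Import Order.TTheory GRing.Theory Num.Theory.
Local Open Scope ring_scope.

(* F[X,Y] is {poly {poly F}}: the outer variable is Y and the inner one is X, *)
(* so that H`_j`_i is the coefficient of X^i Y^j.  In p.[x, y] of polyXY it   *)
(* is the outer variable that takes the value x.                              *)
Definition evalXY (R : nzRingType) (p : {poly {poly R}}) (x y : R) : R :=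
  p.[y%:P].[x].

Definition evalP (R : nzRingType) (p : {poly {poly R}}) (P : R * R) : R :=
  evalXY p P.1 P.2.

Definition monoXY (R : nzRingType) (i j : nat) : {poly {poly R}} :=
  ('X^i : {poly R}) *: 'X^j.

Definition derivX (R : nzRingType) (p : {poly {poly R}}) : {poly {poly R}} :=
  map_poly (@deriv R) p.

Definition derivY (R : nzRingType) (p : {poly {poly R}}) : {poly {poly R}} :=
  p^`().

Definition cab_poly (F : finFieldType) (a b : nat) (H : {poly {poly F}}) :
    Prop :=
  [/\ H`_0`_b != 0 /\ H`_a`_0 != 0,
      forall i j : nat, H`_j`_i != 0 -> (a * i + b * j <= a * b)%N
    & exists U V W : {poly {poly F}},
        U * H + V * derivX H + W * derivY H = 1].

Definition cab_genus (a b : nat) : nat := ((a - 1) * (b - 1))./2.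

Section FunctionField.

Variables (F : finFieldType) (K : fieldType) (iota : {rmorphism F -> K}).
Variables (x y : K).

(* The element p(x,y) of K. *)
Definition fun_of (p : {poly {poly F}}) : K :=
  evalXY (map_poly (map_poly iota) p) x y.

(* K is the field of fractions of F[X,Y]/(H), x and y being the classes of    *)
(* X and Y.                                                                   *)
Definition function_field (H : {poly {poly F}}) : Prop :=
  (forall p, fun_of p = 0 <-> exists q, p = q * H) /\
  (forall f, exists p q, fun_of q != 0 /\ f = fun_of p / fun_of q).

(* A place is represented by its normalized discrete valuation.  The value    *)
(* at 0, which should be +oo, is irrelevant and never used.                   *)
Definition is_place (v : K -> int) : Prop :=
  [/\ forall f g, f != 0 -> g != 0 -> v (f * g) = v f + v g,
      forall f g, f != 0 -> g != 0 -> f + g != 0 ->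
        Num.min (v f) (v g) <= v (f + g),
      forall c : F, c != 0 -> v (iota c) = 0
    & exists2 t, t != 0 & v t = 1].

Definition same_place (v w : K -> int) : Prop :=
  forall f, f != 0 -> v f = w f.

Definition pole (v : K -> int) (f : K) : Prop := f != 0 /\ v f < 0.

(* The residue field of v is F. *)
Definition rational_place (v : K -> int) : Prop :=
  is_place v /\
  forall f, f != 0 -> 0 <= v f ->
    exists c : F, f = iota c \/ 0 < v (f - iota c).

Definition is_Pinf (v : K -> int) : Prop :=
  [/\ rational_place v, pole v x, pole v y
    & forall w, is_place w -> pole w x \/ pole w y -> same_place w v].

(* f is in L(m P), P being the place with valuation v. *)
Definition riemann_roch (v : K -> int) (m : nat) (f : K) : Prop :=
  f != 0 ->
  - (m%:Z) <= v f /\ (forall w, is_place w -> ~ same_place w v -> 0 <= w f).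

(* f is regular at the affine point P of the curve, where it takes value c.   *)
Definition takes_value (f : K) (P : F * F) (c : F) : Prop :=
  exists p q : {poly {poly F}},
    [/\ evalP q P != 0, f = fun_of p / fun_of q & c = evalP p P / evalP q P].

(* C is the code C_H(P,m), v being the valuation of P_infty. *)
Definition is_cab_code (v : K -> int) (n : nat) (P : n.-tuple (F * F))
    (m : nat) (C : {vspace 'rV[F]_n}) : Prop :=
  forall c : 'rV[F]_n, c \in C <->
    exists2 f, riemann_roch v m f
             & forall i : 'I_n, takes_value f (tnth P i) (c ord0 i).

End FunctionField.

(* The pair (i, j) stands for x^i y^j. *)
Definition in_B (a b m : nat) (mu : nat * nat) : bool :=
  (a * mu.1 + b * mu.2 <= m)%N && (mu.2 < a)%N.

(* An element of F[x,y] is evaluated through a lift to F[X,Y]; the result     *)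
(* does not depend on the lift since H vanishes on P.                         *)
Definition ev (F : finFieldType) (n : nat) (P : n.-tuple (F * F))
    (p : {poly {poly F}}) : 'rV[F]_n :=
  \row_(i < n) evalP p (tnth P i).

(* Bhat is a choice, and an ordering, of k monomials of B with linearly       *)
(* independent images.                                                        *)
Definition is_Bhat (F : finFieldType) (a b m n k : nat)
    (P : n.-tuple (F * F)) (Bhat : k.-tuple (nat * nat)) : Prop :=
  all (in_B a b m) Bhat /\
  free [seq ev P (monoXY F mu.1 mu.2) | mu <- Bhat].

Definition varphi (F : finFieldType) (k : nat) (Bhat : k.-tuple (nat * nat))
    (msg : 'rV[F]_k) : {poly {poly F}} :=
  \sum_(l < k)
    (msg ord0 l)%:P *: monoXY F (tnth Bhat l).1 (tnth Bhat l).2.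

Definition phi (F : finFieldType) (n k : nat) (P : n.-tuple (F * F))
    (Bhat : k.-tuple (nat * nat)) (msg : 'rV[F]_k) : 'rV[F]_n :=
  ev P (varphi Bhat msg).

Definition entries (F : finFieldType) (n : nat) (v : 'rV[F]_n) : seq F :=
  [seq v ord0 i | i : 'I_n].

Definition n_X (F : finFieldType) (P : seq (F * F)) : nat :=
  size (undup [seq Q.1 | Q <- P]).

(* Algebraic RAM programs over F.  A program is a decision tree over abstract *)
(* types T (cells holding a field element) and Tb V (tables with entries in   *)
(* V).  An algorithm is a program that is polymorphic in T and Tb: it learns  *)
(* something about field elements only through equality tests and table       *)
(* look-ups, and can build new ones only by the operations listed.  Each      *)
(* operation (arithmetic, constant, test, table creation, insertion,          *)
(* retrieval) costs 1.  Tables are indexed by field elements, points or       *)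
(* exponent pairs.                                                            *)
Definition key (T : Type) : Type := (T + T * T + nat * nat)%type.
Definition KElt (T : Type) (u : T) : key T := inl (inl u).
Definition KPoint (T : Type) (u v : T) : key T := inl (inr (u, v)).
Definition KExp (T : Type) (i j : nat) : key T := inr (i, j).

Inductive arith : Set := OpAdd | OpSub | OpMul.

Inductive prog (F T : Type) (Tb : Type -> Type) (A : Type) : Type :=
| Ret of A
| Const of F & (T -> prog F T Tb A)
| Arith of arith & T & T & (T -> prog F T Tb A)
| Inverse of T & (T -> prog F T Tb A)
| EqTest of T & T & (bool -> prog F T Tb A)
| NewTable V of (Tb V -> prog F T Tb A)
| Insert V of Tb V & key T & V & (Tb V -> prog F T Tb A)
| Lookup V of Tb V & key T & (option V -> prog F T Tb A).

Arguments Ret {F T Tb A}.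
Arguments Const {F T Tb A}.
Arguments Arith {F T Tb A}.
Arguments Inverse {F T Tb A}.
Arguments EqTest {F T Tb A}.
Arguments NewTable {F T Tb A V}.
Arguments Insert {F T Tb A V}.
Arguments Lookup {F T Tb A V}.

Fixpoint bind (F T : Type) (Tb : Type -> Type) (A B : Type)
    (p : prog F T Tb A) (k : A -> prog F T Tb B) : prog F T Tb B :=
  match p with
  | Ret r => k r
  | Const c q => Const c (fun r => bind (q r) k)
  | Arith o u v q => Arith o u v (fun r => bind (q r) k)
  | Inverse u q => Inverse u (fun r => bind (q r) k)
  | EqTest u v q => EqTest u v (fun r => bind (q r) k)
  | NewTable _ q => NewTable (fun r => bind (q r) k)
  | Insert _ t i e q => Insert t i e (fun r => bind (q r) k)
  | Lookup _ t i q => Lookup t i (fun r => bind (q r) k)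
  end.

Declare Scope prog_scope.
Delimit Scope prog_scope with prog.
Notation "'let*' r := p 'in' q" := (bind p (fun r => q))
  (at level 200, r name, p at level 100, q at level 200,
   format "'[v' 'let*'  r  :=  p  'in' '/' q ']'") : prog_scope.
Local Open Scope prog_scope.

Definition memo (F V : Type) : Type := key F -> option V.

Definition arith_fun (F : fieldType) (o : arith) (u v : F) : F :=
  match o with OpAdd => u + v | OpSub => u - v | OpMul => u * v end.

(* Result of a program, and number of operations performed. *)
Fixpoint run (F : finFieldType) (A : Type) (p : prog F F (memo F) A) :
    A * nat :=
  let tick (r : A * nat) := (r.1, r.2.+1) in
  match p with
  | Ret r => (r, 0%N)
  | Const c q => tick (run (q c))
  | Arith o u v q => tick (run (q (arith_fun o u v)))
  | Inverse u q => tick (run (q u^-1))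
  | EqTest u v q => tick (run (q (u == v)))
  | NewTable _ q => tick (run (q (fun=> None)))
  | Insert _ t i e q => tick (run (q (fun j => if j == i then Some e else t j)))
  | Lookup _ t i q => tick (run (q (t i)))
  end.

Definition output (F : finFieldType) (A : Type) (p : prog F F (memo F) A) : A :=
  (run p).1.
Definition cost (F : finFieldType) (A : Type) (p : prog F F (memo F) A) : nat :=
  (run p).2.

(* A polynomial is handed over as its list of coefficients, constant term     *)
(* first.                                                                     *)
Definition mul_algo (F : Type) : Type :=
  forall (T : Type) (Tb : Type -> Type), seq T -> seq T -> prog F T Tb (seq T).

Definition mpe_algo (F : Type) : Type :=
  forall (T : Type) (Tb : Type -> Type), seq T -> seq T -> prog F T Tb (Tb T).

Section Algorithms.

Variables (F : nzRingType) (T : Type) (Tb : Type -> Type).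
Local Notation prog := (prog F T Tb).

Fixpoint mapM (A B : Type) (h : A -> prog B) (s : seq A) : prog (seq B) :=
  if s is e :: s' then
    let* r := h e in
    let* rs := mapM h s' in
    Ret (r :: rs)
  else Ret [::].

Fixpoint foldM (A S : Type) (h : S -> A -> prog S) (st : S) (s : seq A) :
    prog S :=
  if s is e :: s' then
    let* st' := h st e in
    foldM h st' s'
  else Ret st.

Definition new_table (V : Type) : prog (Tb V) := NewTable Ret.
Definition insert (V : Type) (t : Tb V) (i : key T) (e : V) : prog (Tb V) :=
  Insert t i e Ret.
Definition lookup (V : Type) (t : Tb V) (i : key T) : prog (option V) :=
  Lookup t i Ret.

(* Retrieval in a table of field elements, absent entries being read as 0. *)
Definition get (t : Tb T) (i : key T) : prog T :=
  let* o := lookup t i in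
  if o is Some u then Ret u else Const 0 Ret.

(* Removes the zero leading coefficients. *)
Fixpoint trim (s : seq T) : prog (seq T) :=
  if s is u :: s' then
    let* r := trim s' in
    if r is [::] then
      Const 0 (fun z => EqTest u z (fun e => Ret (if e then [::] else [:: u])))
    else Ret (u :: r)
  else Ret [::].

(* The list X(P), and the table of the lists Y_alpha(P), alpha in X(P). *)
Definition abscissae (pts : seq (T * T)) : prog (seq T * Tb (seq T)) :=
  let* t0 := new_table (seq T) in
  foldM (fun (st : seq T * Tb (seq T)) (Q : T * T) =>
    let* o := lookup st.2 (KElt Q.1) in
    match o with
    | None =>
        let* t := insert st.2 (KElt Q.1) [:: Q.2] in
        Ret (Q.1 :: st.1, t)
    | Some bs =>
        let* t := insert st.2 (KElt Q.1) (Q.2 :: bs) in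
        Ret (st.1, t)
    end) ([::], t0) pts.

(* f is the list of the coefficient lists of f_0, ..., f_{d_Y}. *)
Definition bivariate_mpe (mpe : mpe_algo F) (f : seq (seq T))
    (pts : seq (T * T)) : prog (Tb T) :=
  let* XY := abscissae pts in
  let* Fs := mapM (fun fi =>
    let* fi' := trim fi in
    mpe T Tb fi' XY.1) f in
  let* g0 := new_table (Tb T) in
  let* G := foldM (fun (G : Tb (Tb T)) (al : T) =>
    let* g := mapM (fun Fi => get Fi (KElt al)) Fs in
    let* g' := trim g in
    let* o := lookup XY.2 (KElt al) in
    let* Ga := mpe T Tb g' (odflt [::] o) in
    insert G (KElt al) Ga) g0 XY.1 in
  let* r0 := new_table T in
  foldM (fun (r : Tb T) (Q : T * T) =>
    let* o := lookup G (KElt Q.1) in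
    match o with
    | None => Ret r
    | Some Ga =>
        let* u := get Ga (KElt Q.2) in
        insert r (KPoint Q.1 Q.2) u
    end) r0 pts.

(* Standard form of varphi(msg): first a table of coefficients, then, for     *)
(* each j <= a - 1 with b j <= m, the coefficients of X^i Y^j for all i with  *)
(* a i + b j <= m.                                                            *)
Definition standard_form (a b m : nat) (Bhat : seq (nat * nat)) (msg : seq T) :
    prog (seq (seq T)) :=
  let* c0 := new_table T in
  let* c := foldM (fun (c : Tb T) (e : (nat * nat) * T) =>
    insert c (KExp T e.1.1 e.1.2) e.2) c0 (zip Bhat msg) in
  mapM (fun j => mapM (fun i => get c (KExp T i j))
                      (iota 0 ((m - b * j) %/ a).+1))
       (iota 0 (minn a (m %/ b).+1)).

Definition encode (mpe : mpe_algo F) (a b m : nat) (Bhat : seq (nat * nat))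
    (pts : seq (T * T)) (msg : seq T) : prog (seq T) :=
  let* f := standard_form a b m Bhat msg in
  let* r := bivariate_mpe mpe f pts in
  mapM (fun Q => get r (KPoint Q.1 Q.2)) pts.

End Algorithms.


(* M n bounds the cost of multiplying polynomials of degree at most n over F, *)
(* and has the usual regularity of multiplication times: it is superadditive, *)
(* and M(2n) is O(M(n)).                                                      *)
Definition multiplication_time (R : realType) (kappa : R) (F : finFieldType)
    (M : nat -> R) : Prop :=
  [/\ exists mul : mul_algo F,
        forall (n : nat) (p q : {poly F}),
          (size p <= n.+1)%N -> (size q <= n.+1)%N ->
          let r := mul F (memo F) (p : seq F) (q : seq F) in
          Poly (output r) = p * q /\ (cost r)%:R <= M n,
      forall n : nat, (0 < n)%N -> 1 <= M n,
      forall n1 n2 : nat, (0 < n1)%N -> (0 < n2)%N -> M n1 + M n2 <= M (n1 + n2)%N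
    & forall n : nat, (0 < n)%N -> M (2 * n)%N <= kappa * M n].

(* Evaluation of h on S takes O(M(d) log d) operations, d = deg h + |S|; for  *)
(* d <= 1, where log d is not positive, this is read as O(1).                 *)
Definition univariate_mpe_spec (R : realType) (kappa : R) (F : finFieldType)
    (M : nat -> R) (mpe : mpe_algo F) : Prop :=
  forall (h : {poly F}) (S : seq F), uniq S ->
    let r := mpe F (memo F) (h : seq F) S in
    let d := ((size h).-1 + size S)%N in
    (forall al, al \in S -> output r (KElt al) = Some h.[al]) /\
    (cost r)%:R <= (if (d <= 1)%N then kappa else kappa * (M d * ln d%:R)).

Definition bigO (R : realType) (f g : nat -> R) : Prop :=
  exists (C : R) (n0 : nat), forall n, (n0 <= n)%N -> `|f n| <= C * `|g n|.

Definition softO (R : realType) (f h : nat -> R) : Prop :=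
  exists c : nat, bigO f (fun n => h n * ln (h n) ^+ c).

(* Main.v *)
Require Import Defs.
From HB Require Import structures.
From mathcomp Require Import all_boot all_order all_algebra.
From mathcomp Require Import reals exp.
From mathcomp Require Import zify ring lra.

Set Implicit Arguments.
Unset Strict Implicit.
Unset Printing Implicit Defensive.

Import Order.TTheory GRing.Theory Num.Theory.
Local Open Scope ring_scope.

(** Three independent facts make up the theorem.

    The output is a codeword. The equation H(x,y) = 0 forces b v(x) = a v(y)
    at the common pole of x and y, since otherwise x^b or y^a would be its only
    monomial of least valuation (no_dominant_monomial). As a and b are coprime,
    v(x) = - s a and v(y) = - s b for some s > 0. The monomials of a standard
    form have distinct values of a i + b j, so they never cancel and v takes
    only multiples of s on the function field; v being normalised, s = 1
    (val_xy). Hence a combination of monomials of B has pole order at most m at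
    this place, and it is regular at every other one because x and y are, so
    its evaluation lies in the code (phi_in_code).

    The output is phi(msg). The exponents (i, j) visited when the
    coefficient lists are built are exactly those of B (standard_form_correct),
    and evaluating at all abscissae and then, along each fibre, at all ordinates
    evaluates at every point (bivariate_mpe_correct).

    The cost is as announced. Let N = m + a n_X. Over each abscissa alpha there
    are at most a points, the roots of H(alpha, Y), so n <= a n_X <= N, and
    everything outside the univariate evaluations is linear in N. The first
    family of evaluations has at most a members f_j, of degree at most m / a, on
    n_X points, hence total size at most N; the second has n_X members of degree
    below a on the fibres, hence total size at most 2 N. Superadditivity of M
    bounds each family by one evaluation of its total size (mpe_family), M(2 N)
    is O(M(N)), and M(N) >= N absorbs the linear part (cost_encode). *)

(** * Output and cost of composite programs *)

Section RunRules.

Variable F : finFieldType.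
Local Notation prog := (prog F F (memo F)).

Lemma run_bind (A B : Type) (p : prog A) (k : A -> prog B) :
  run (bind p k) =
    (output (k (output p)), (cost p + cost (k (output p)))%N).
Proof.
rewrite /output /cost.
elim: p => [r|c q IH|o u v q IH|u q IH|u v q IH|V q IH|V t i e q IH|V t i q IH] /=;
  by rewrite ?IH //; case: (run _).
Qed.

Lemma output_bind (A B : Type) (p : prog A) (k : A -> prog B) :
  output (bind p k) = output (k (output p)).
Proof. by rewrite {1}/output run_bind. Qed.

Lemma cost_bind (A B : Type) (p : prog A) (k : A -> prog B) :
  cost (bind p k) = (cost p + cost (k (output p)))%N.
Proof. by rewrite {1}/cost run_bind. Qed.

Lemma output_mapM (A B : Type) (h : A -> prog B) (s : seq A) :
  output (mapM h s) = [seq output (h e) | e <- s].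
Proof. by elim: s => //= e s IH; rewrite !output_bind IH. Qed.

Lemma cost_mapM (A B : Type) (h : A -> prog B) (s : seq A) :
  cost (mapM h s) = (\sum_(e <- s) cost (h e))%N.
Proof.
elim: s => [|e s IH]; first by rewrite big_nil.
by rewrite big_cons /= !cost_bind IH addn0.
Qed.

Lemma output_foldM (A S : Type) (h : S -> A -> prog S) (st : S) (s : seq A) :
  output (foldM h st s) = foldl (fun st e => output (h st e)) st s.
Proof. by elim: s st => //= e s IH st; rewrite output_bind IH. Qed.

Lemma cost_foldM (A S : Type) (h : S -> A -> prog S) (c : A -> nat) (st : S)
    (s : seq A) :
  (forall st e, cost (h st e) <= c e)%N ->
  (cost (foldM h st s) <= \sum_(e <- s) c e)%N.
Proof.
move=> hc; elim: s st => [|e s IH] st; first by rewrite big_nil.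
by rewrite big_cons /= cost_bind leq_add.
Qed.

Lemma output_insert (V : Type) (t : memo F V) (i : key F) (e : V) :
  output (insert F t i e) = fun j => if j == i then Some e else t j.
Proof. by []. Qed.

Lemma output_lookup (V : Type) (t : memo F V) (i : key F) :
  output (lookup F t i) = t i.
Proof. by []. Qed.

Lemma output_get (t : memo F F) (i : key F) : output (get F t i) = odflt 0 (t i).
Proof. by rewrite /get output_bind /output /=; case: (t i). Qed.

Lemma cost_get (t : memo F F) (i : key F) : (cost (get F t i) <= 2)%N.
Proof. by rewrite /get cost_bind /cost /output /=; case: (t i). Qed.

Lemma output_trim (s : seq F) : output (trim F (memo F) s) = Poly s :> seq F.
Proof.
elim: s => [|u s IH] /=; first by rewrite polyseq0.
rewrite output_bind IH polyseq_cons nil_poly -size_poly_eq0.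
case E: (polyseq (Poly s)) => [|v r] //=.
by rewrite polyseqC /output /=; case: eqP.
Qed.

Lemma cost_trim (s : seq F) : (cost (trim F (memo F) s) <= 2 * size s)%N.
Proof.
elim: s => [|u s IH] //=; rewrite cost_bind mulnS addnC leq_add //.
by case: (output _).
Qed.

(** Later insertions overwrite earlier ones, so the value found at a key is
    determined as soon as all the insertions at that key agree. *)
Lemma output_inserts (A : eqType) (V : Type) (h : memo F V -> A -> prog (memo F V))
    (k : A -> key F) (v : A -> V) (t : memo F V) (s : seq A) (i : key F) (u : V) :
  (forall t e, e \in s ->
     output (h t e) = fun j => if j == k e then Some (v e) else t j) ->
  {in s, forall e, k e = i -> v e = u} ->
  output (foldM h t s) i = if i \in map k s then Some u else t i.
Proof.
rewrite output_foldM; elim: s t => //= e s IH t hh hu.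
rewrite IH; last 2 first.
- by move=> t' e' es; apply: hh; rewrite inE es orbT.
- by move=> e' es; apply: hu; rewrite inE es orbT.
rewrite inE hh ?inE ?eqxx //; case: (i \in _); first by rewrite orbT.
by rewrite orbF; case: eqP => // ie; rewrite hu ?inE ?eqxx.
Qed.

End RunRules.

Section Correctness.

Variable F : finFieldType.

(** * Correctness of the encoder *)

(** The polynomial denoted by the nested lists that programs exchange: one
    list per power of Y, constant terms first and trailing zeros allowed. *)
Definition Poly2 (f : seq (seq F)) : {poly {poly F}} :=
  Poly [seq Poly fj | fj <- f].

Lemma coef_Poly2 (f : seq (seq F)) (i j : nat) : (Poly2 f)`_j`_i = (nth [::] f j)`_i.
Proof.
rewrite coef_Poly; have [jf|jf] := ltnP j (size f).
  by rewrite (nth_map [::]) // coef_Poly.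
by rewrite !nth_default ?size_map ?polyseq0 ?(nth_default [::]) ?nth_nil.
Qed.

Lemma evalXY_sum (R : comNzRingType) (p : {poly {poly R}}) (x y : R) (n : nat) :
  (size p <= n)%N -> evalXY p x y = \sum_(j < n) (p`_j).[x] * y ^+ j.
Proof.
move=> pn; rewrite /evalXY (horner_coef_wide _ pn) horner_sum.
by apply: eq_bigr => j _; rewrite hornerM -rmorphXn hornerC.
Qed.

(** Why the two-stage evaluation works: evaluating the coefficients at x
    leaves a univariate polynomial, whose value at y is the value sought. *)
Lemma evalXY_Poly2 (f : seq (seq F)) (x y : F) :
  evalXY (Poly2 f) x y = (Poly [seq (Poly fj).[x] | fj <- f]).[y].
Proof.
rewrite (@evalXY_sum _ _ _ _ (size f)); last first.
  by rewrite (leq_trans (size_Poly _)) ?size_map.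
rewrite (@horner_coef_wide _ (size f)); last first.
  by rewrite (leq_trans (size_Poly _)) ?size_map.
apply: eq_bigr => j _; rewrite !coef_Poly !(nth_map [::]) //.
Qed.

Definition fibre (pts : seq (F * F)) (al : F) : seq F :=
  [seq Q.2 | Q <- pts & Q.1 == al].

Lemma fibre_uniq (pts : seq (F * F)) (al : F) : uniq pts -> uniq (fibre pts al).
Proof.
move=> up; rewrite map_inj_in_uniq ?filter_uniq // => -[x1 y1] [x2 y2].
by rewrite !mem_filter /= => /andP[/eqP-> _] /andP[/eqP-> _] ->.
Qed.

Lemma mem_fibre (pts : seq (F * F)) (al be : F) :
  (be \in fibre pts al) = ((al, be) \in pts).
Proof.
apply/mapP/idP => [[[x y]]|H]; last by exists (al, be); rewrite ?mem_filter ?eqxx.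
by rewrite mem_filter /= => /andP[/eqP<- h] ->.
Qed.

(** New abscissae and ordinates are put in front, hence the reversals: both
    lists are those of a traversal of the points backwards. *)
Lemma output_abscissae (pts : seq (F * F)) :
  let XY := output (abscissae F (memo F) pts) in
  XY.1 = undup (rev [seq Q.1 | Q <- pts]) /\
  forall al, XY.2 (KElt al) =
    if al \in [seq Q.1 | Q <- pts] then Some (rev (fibre pts al)) else None.
Proof.
rewrite /abscissae output_bind output_foldM /=.
elim/last_ind: pts => [|pts Q [IH1 IH2]] //=.
rewrite foldl_rcons; set st := foldl _ _ _ in IH1 IH2 *.
rewrite map_rcons rev_rcons /= mem_rev.
rewrite /output /= IH2; case: ifP => hQ /=; split => //=.
- move=> al; rewrite mem_rcons inE /fibre filter_rcons.
  case: (eqVneq al Q.1) => [->|ne] /=; last first.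
    by rewrite (inj_eq (@inl_inj _ _)) (inj_eq (@inl_inj _ _)) (negPf ne) IH2.
  by rewrite !eqxx /= map_rcons rev_rcons.
- by rewrite IH1.
- move=> al; rewrite mem_rcons inE /fibre filter_rcons.
  case: (eqVneq al Q.1) => [->|ne] /=; last first.
    by rewrite (inj_eq (@inl_inj _ _)) (inj_eq (@inl_inj _ _)) (negPf ne) IH2.
  rewrite !eqxx /= map_rcons rev_rcons; congr (Some (_ :: _)).
  have /eqP-> : (filter (fun Q' : F * F => Q'.1 == Q.1) pts == [::]) => //.
  rewrite -[_ == _]negbK -has_filter; apply: contraFN hQ => /hasP[Q' hQ' /eqP<-].
  exact: map_f.
Qed.

Lemma cost_abscissae (pts : seq (F * F)) :
  (cost (abscissae F (memo F) pts) <= 1 + 2 * size pts)%N.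
Proof.
rewrite /abscissae cost_bind leq_add2l mulnC -sum1_size big_distrl /=.
apply: cost_foldM => st Q; rewrite /cost /=.
by case: (st.2 _).
Qed.

(** The fibres have no repetitions since the points have none, so the
    specification of the univariate algorithm applies in both stages. *)
Lemma bivariate_mpe_correct (mpe : mpe_algo F) (f : seq (seq F))
    (pts : seq (F * F)) (al be : F) :
  (forall (h : {poly F}) (S : seq F), uniq S -> forall ga, ga \in S ->
     output (mpe F (memo F) (h : seq F) S) (KElt ga) = Some h.[ga]) ->
  uniq pts -> (al, be) \in pts ->
  output (@bivariate_mpe F F (memo F) mpe f pts) (KPoint al be) =
  Some (evalXY (Poly2 f) al be).
Proof.
move=> hmpe upts hQ; rewrite /bivariate_mpe output_bind.
have := output_abscissae pts; case: (output (abscissae _ _ pts)) => X Y []; cbn [fst snd] => -> hY {X}.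
set X := undup _; rewrite !output_bind; set G := output (foldM _ _ X).
have memX ga : (ga \in X) = (ga \in [seq Q.1 | Q <- pts]).
  by rewrite mem_undup mem_rev.
have hG ga : ga \in X -> exists2 Ga, G (KElt ga) = Some Ga &
    forall de, (ga, de) \in pts ->
      Ga (KElt de) = Some (evalXY (Poly2 f) ga de).
  move=> hga; rewrite /G.
  pose g al := [seq (Poly fj).[al] | fj <- f].
  pose v al := output (mpe F (memo F) (Poly (g al)) (rev (fibre pts al))).
  rewrite (@output_inserts _ _ _ _ (@KElt F) v _ _ _ (v ga)); last 2 first.
  - move=> t e he; rewrite !output_bind output_insert output_lookup output_trim.
    rewrite hY -memX he /v !output_mapM -map_comp /=.
    rewrite (_ : map _ f = g e) //; apply: eq_map => fj /=.
    by rewrite output_get output_bind output_trim hmpe ?undup_uniq.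
  - by move=> e _ [->].
  rewrite map_f //; exists (v ga) => // de hde; rewrite /v hmpe //.
  - by rewrite -evalXY_Poly2.
  - by rewrite rev_uniq fibre_uniq.
  - by rewrite mem_rev mem_fibre.
rewrite (@output_inserts _ _ _ _ (fun Q => KPoint Q.1 Q.2)
  (fun Q => evalXY (Poly2 f) Q.1 Q.2) _ _ _ (evalXY (Poly2 f) al be)).
- by rewrite (map_f (fun Q => KPoint Q.1 Q.2) hQ).
- move=> t [ga de] he; have [|Ga hGa hv] := hG ga.
    by rewrite memX (map_f fst he).
  by rewrite output_bind output_lookup hGa output_bind output_get (hv _ he).
- by move=> [ga de] _ [-> ->].
Qed.

Lemma coef_varphi (k : nat) (Bhat : k.-tuple (nat * nat)) (msg : 'rV[F]_k)
    (i j : nat) :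
  (varphi Bhat msg)`_j`_i =
  \sum_(l < k) if tnth Bhat l == (i, j) then msg ord0 l else 0.
Proof.
rewrite /varphi coef_sum coef_sum; apply: eq_bigr => l _.
rewrite /monoXY !coefZ coefXn; case: (tnth Bhat l) => i' j' /=.
rewrite coefCM xpair_eqE [i' == _]eq_sym [j' == _]eq_sym [in RHS]andbC.
by case: (j == j'); rewrite ?mulr0 ?coef0 ?mulr0 // mulr1 coefXn mulr_natr mulrb.
Qed.

Lemma coef_varphi_mem (k : nat) (Bhat : k.-tuple (nat * nat)) (msg : 'rV[F]_k)
    (l : 'I_k) :
  uniq Bhat ->
  (varphi Bhat msg)`_((tnth Bhat l).2)`_((tnth Bhat l).1) = msg ord0 l.
Proof.
move=> /tuple_uniqP uB; rewrite coef_varphi -surjective_pairing (bigD1 l) //=.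
rewrite eqxx big1 ?addr0 // => l' ne; case: eqP => // /uB e.
by rewrite e eqxx in ne.
Qed.

Lemma coef_varphi_notin (k : nat) (Bhat : k.-tuple (nat * nat)) (msg : 'rV[F]_k)
    (i j : nat) :
  (i, j) \notin Bhat -> (varphi Bhat msg)`_j`_i = 0.
Proof.
move=> nB; rewrite coef_varphi big1 // => l _; case: eqP => // e.
by rewrite -e mem_tnth in nB.
Qed.

Lemma zip_entries (k : nat) (Bhat : k.-tuple (nat * nat)) (msg : 'rV[F]_k) :
  zip Bhat (entries msg) = [seq (tnth Bhat l, msg ord0 l) | l <- enum 'I_k].
Proof. by rewrite -{1}[Bhat : seq _]map_tnth_enum /entries /image_mem zip_map. Qed.

(** The grid over which the lists are filled is exactly the set of exponents
    of B, so it misses no monomial of Bhat; monomials outside Bhat are absent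
    from the table and read as 0. Without repetitions in Bhat no insertion
    overwrites another. *)
Lemma standard_form_correct (a b m k : nat) (Bhat : k.-tuple (nat * nat))
    (msg : 'rV[F]_k) :
  (0 < a)%N -> (0 < b)%N -> uniq Bhat -> all (in_B a b m) Bhat ->
  Poly2 (output (standard_form F (memo F) a b m Bhat (entries msg))) =
  varphi Bhat msg.
Proof.
move=> a0 b0 uB inB; rewrite /standard_form !output_bind zip_entries.
set c := output (foldM _ _ _).
have hc i j : odflt 0 (c (KExp F i j)) = (varphi Bhat msg)`_j`_i.
  rewrite /c (@output_inserts _ _ _ _ (fun e => KExp F e.1.1 e.1.2) snd _ _ _
    (varphi Bhat msg)`_j`_i) //; last first.
    move=> e /mapP[l _ -> /=] [<- <-].
    by rewrite coef_varphi_mem.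
  case: ifPn => //= hn; rewrite coef_varphi_notin //.
  apply: contra hn => /tnthP[l e]; apply/mapP.
  exists (tnth Bhat l, msg ord0 l); last by rewrite -e.
  by rewrite (map_f (fun l => (tnth Bhat l, msg ord0 l))) ?mem_enum.
apply/polyP => j; apply/polyP => i; rewrite coef_Poly2 output_mapM.
have notB : ~~ ((a * i + b * j <= m) && (j < a))%N -> (varphi Bhat msg)`_j`_i = 0.
  move=> h; apply: coef_varphi_notin; apply: contra h.
  by move/(allP inB); rewrite /in_B.
have [jJ|jJ] := ltnP j (minn a (m %/ b).+1); last first.
  rewrite (nth_default [::]) ?size_map ?size_iota // nth_nil notB //.
  apply: contraL jJ => /andP[h ja]; rewrite -ltnNge leq_min ja ltnS leq_divRL //.
  by rewrite mulnC (leq_trans (leq_addl _ _) h).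
move: (jJ); rewrite leq_min ltnS leq_divRL // mulnC => /andP[ja bj].
rewrite (nth_map 0%N) ?size_iota // nth_iota // add0n output_mapM.
have [iI|iI] := ltnP i ((m - b * j) %/ a).+1.
  by rewrite (nth_map 0%N) ?size_iota // nth_iota // add0n output_get hc.
rewrite nth_default ?size_map ?size_iota // notB // ja andbT.
apply: contraL iI => h; rewrite -ltnNge ltnS leq_divRL // mulnC.
by rewrite -(leq_add2r (b * j)) subnK.
Qed.

Lemma entries_ev (n : nat) (P : n.-tuple (F * F)) (p : {poly {poly F}}) :
  entries (ev P p) = [seq evalP p Q | Q <- P].
Proof.
rewrite -[in RHS](map_tnth_enum P) -map_comp; apply: eq_map => i /=.
by rewrite mxE.
Qed.

Lemma encode_correct (mpe : mpe_algo F) (a b m n k : nat) (P : n.-tuple (F * F))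
    (Bhat : k.-tuple (nat * nat)) (msg : 'rV[F]_k) :
  (forall (h : {poly F}) (S : seq F), uniq S -> forall ga, ga \in S ->
     output (mpe F (memo F) (h : seq F) S) (KElt ga) = Some h.[ga]) ->
  (0 < a)%N -> (0 < b)%N -> uniq P -> uniq Bhat -> all (in_B a b m) Bhat ->
  output (@encode F F (memo F) mpe a b m Bhat P (entries msg)) =
  entries (phi P Bhat msg).
Proof.
move=> hmpe a0 b0 uP uB inB.
rewrite entries_ev -(standard_form_correct msg a0 b0 uB inB).
rewrite /encode output_bind output_bind output_mapM.
apply/eq_in_map => -[al be] hQ.
by rewrite output_get (bivariate_mpe_correct _ hmpe uP hQ).
Qed.

End Correctness.

(** * Counting points and monomials *)

Section Counting.

Variable F : finFieldType.

(** The weight condition leaves Y^a alone in degree a and nothing above it, so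
    H has a constant leading coefficient as a polynomial in Y. *)
Lemma cab_lead (a b : nat) (H : {poly {poly F}}) :
  (0 < a)%N -> (0 < b)%N -> cab_poly a b H ->
  size H = a.+1 /\ H`_a = (H`_a`_0)%:P.
Proof.
move=> a0 b0 [[_ Ha] Hab _]; split.
  apply/eqP; rewrite eqn_leq; apply/andP; split; last first.
    by rewrite ltnNge; apply: contra Ha => /leq_sizeP/(_ a (leqnn a)) ->; rewrite coef0.
  apply/leq_sizeP => j aj; apply/polyP => i; rewrite coef0; apply/eqP.
  apply: contraTT aj => /Hab h; rewrite -ltnNge ltnS -(leq_pmul2l b0) mulnC.
  by rewrite [(b * a)%N]mulnC mulnC; apply: leq_trans h; apply: leq_addl.
apply/polyP => -[|i]; rewrite coefC //=; apply/eqP; apply/negPn/negP => /Hab.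
by rewrite [(b * a)%N]mulnC -[leqRHS]add0n leq_add2r leqn0 muln_eq0 -leqn0 leqNgt a0.
Qed.

(** The fibre consists of roots of H(alpha, Y), which has degree exactly a
    because its leading coefficient does not depend on alpha. *)
Lemma size_fibre (a b : nat) (H : {poly {poly F}}) (pts : seq (F * F)) (al : F) :
  (0 < a)%N -> (0 < b)%N -> cab_poly a b H ->
  uniq pts -> (forall Q, Q \in pts -> evalP H Q = 0) ->
  (size (fibre pts al) <= a)%N.
Proof.
move=> a0 b0 cH up Hp; have [sH lH] := cab_lead a0 b0 cH.
pose h := \poly_(j < a.+1) (H`_j).[al].
have ha : h`_a = H`_a`_0 by rewrite coef_poly ltnSn lH hornerC coefC.
rewrite -ltnS; apply: leq_trans (size_poly _ _ : (size h <= _)%N).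
apply: max_poly_roots; last exact: fibre_uniq.
  by case: cH => -[_ cHa] _ _; apply: contraNneq cHa => h0; rewrite -ha h0 coef0.
apply/allP => be; rewrite mem_fibre => /Hp; rewrite /evalP /= => e.
by rewrite /root horner_poly -(evalXY_sum _ _ (eq_leq sH)) e.
Qed.

Lemma sum_size_fibre (pts : seq (F * F)) (X : seq F) :
  uniq X -> {subset [seq Q.1 | Q <- pts] <= X} ->
  (\sum_(al <- X) size (fibre pts al) = size pts)%N.
Proof.
move=> uX; elim: pts => [|Q pts IH] /= sub; first by rewrite big1.
have h : {subset [seq Q.1 | Q <- pts] <= X}.
  by move=> z hz; apply: sub; rewrite inE hz orbT.
rewrite -(IH h) -[RHS]add1n.
have <- : (\sum_(al <- X) (Q.1 == al) = 1)%N.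
  rewrite -big_mkcond /= sum1_count (eq_count (a2 := pred1 Q.1)).
    by rewrite count_uniq_mem // sub // inE eqxx.
  by move=> z /=; rewrite eq_sym.
rewrite -big_split; apply: eq_bigr => al _; rewrite /fibre /=.
by case: eqP.
Qed.

Lemma n_X_rev (pts : seq (F * F)) :
  size (undup (rev [seq Q.1 | Q <- pts])) = n_X pts.
Proof.
apply/eqP; rewrite -uniq_size_uniq ?undup_uniq // => z.
by rewrite !mem_undup mem_rev.
Qed.

Lemma size_points (a b : nat) (H : {poly {poly F}}) (pts : seq (F * F)) :
  (0 < a)%N -> (0 < b)%N -> cab_poly a b H ->
  uniq pts -> (forall Q, Q \in pts -> evalP H Q = 0) ->
  (size pts <= a * n_X pts)%N.
Proof.
move=> a0 b0 cH up Hp.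
rewrite -(@sum_size_fibre pts (undup [seq Q.1 | Q <- pts])) ?undup_uniq //; last first.
  by move=> z; rewrite mem_undup.
rewrite /n_X -sum1_size big_distrr /= leq_sum // => al _.
by rewrite muln1 (size_fibre _ a0 b0 cH).
Qed.

Lemma Bhat_uniq (a b m n k : nat) (P : n.-tuple (F * F)) (Bhat : k.-tuple (nat * nat)) :
  is_Bhat a b m P Bhat -> uniq Bhat.
Proof. by case=> _ /free_uniq; apply: map_uniq. Qed.

(** The images of the monomials are linearly independent in F^n. *)
Lemma Bhat_size (a b m n k : nat) (P : n.-tuple (F * F)) (Bhat : k.-tuple (nat * nat)) :
  is_Bhat a b m P Bhat -> (k <= n)%N.
Proof.
case=> _ /eqP; rewrite size_map size_tuple => <-.
apply: leq_trans (dimvS (subvf _)) _; by rewrite dimvf dim_matrix mul1r.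
Qed.

End Counting.

(** * Valuations of polynomial expressions in x and y *)

Section Valuations.

Variables (F : finFieldType) (K : fieldType) (iota : {rmorphism F -> K}).
Variables (x y : K).
Local Notation fxy := (fun_of iota x y).

Lemma fun_of_is_zmod_morphism : zmod_morphism fxy.
Proof. by move=> p q; rewrite /fun_of /evalXY rmorphB !hornerE. Qed.

Lemma fun_of_is_monoid_morphism : monoid_morphism fxy.
Proof.
split; first by rewrite /fun_of /evalXY rmorph1 !hornerE.
by move=> p q; rewrite /fun_of /evalXY rmorphM !hornerE.
Qed.

HB.instance Definition _ :=
  GRing.isZmodMorphism.Build {poly {poly F}} K fxy fun_of_is_zmod_morphism.
HB.instance Definition _ :=
  GRing.isMonoidMorphism.Build {poly {poly F}} K fxy fun_of_is_monoid_morphism.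

Lemma fun_of_sum (p : {poly {poly F}}) (n1 n2 : nat) :
  (size p <= n2)%N -> (forall j, (size (p`_j)%R <= n1)%N) ->
  fxy p = \sum_(u : 'I_n1 * 'I_n2) iota p`_(u.2)`_(u.1) * x ^+ u.1 * y ^+ u.2.
Proof.
move=> s2 s1; rewrite /fun_of (@evalXY_sum _ _ _ _ n2); last first.
  exact: leq_trans (size_poly _ _) s2.
rewrite -(pair_bigA _ (fun (i : 'I_n1) (j : 'I_n2) => iota p`_j`_i * x ^+ i * y ^+ j)).
rewrite exchange_big; apply: eq_bigr => j _; rewrite /= -mulr_suml; congr (_ * _).
rewrite coef_map (@horner_coef_wide _ n1) ?size_map_poly //.
by apply: eq_bigr => i _; rewrite coef_map.
Qed.

Variables (v : K -> int) (vP : is_place iota v).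

(** The valuation of 0 counts as infinite, which makes this condition stable
    under sums. *)
Definition vge (n : int) (f : K) : Prop := f = 0 \/ n <= v f.

Lemma valM f g : f != 0 -> g != 0 -> v (f * g) = v f + v g.
Proof. by case: vP => h _ _ _; apply: h. Qed.

Lemma val_const c : c != 0 -> v (iota c) = 0.
Proof. by case: vP => _ _ h _; apply: h. Qed.

Lemma val1 : v 1 = 0.
Proof. by rewrite -(rmorph1 iota) val_const ?oner_neq0. Qed.

Lemma valN f : f != 0 -> v (- f) = v f.
Proof.
move=> f0; rewrite -mulN1r valM ?oppr_eq0 ?oner_neq0 //.
by rewrite -(rmorph1 iota) -rmorphN val_const ?add0r // oppr_eq0 oner_neq0.
Qed.

Lemma valX f n : f != 0 -> v (f ^+ n) = v f *+ n.
Proof.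
move=> f0; elim: n => [|n IH]; first by rewrite val1.
by rewrite exprS valM ?expf_neq0 // IH mulrS.
Qed.

Lemma val_min f g : f != 0 -> g != 0 -> v f < v g -> f + g != 0 /\ v (f + g) = v f.
Proof.
move=> f0 g0 fg; case: vP => _ tri _ _.
have s0 : f + g != 0.
  rewrite addr_eq0; apply: contraTneq fg => ->.
  by rewrite valN // ltxx.
split=> //; apply/eqP; rewrite eq_le; apply/andP; split; last first.
  by have := tri f g f0 g0 s0; rewrite (min_l (ltW fg)).
have e : f = (f + g) + - g by rewrite addrK.
have := tri (f + g) (- g) s0; rewrite oppr_eq0 valN // -e => /(_ g0 f0).
by rewrite ge_min => /orP[//|]; rewrite leNgt fg.
Qed.

Lemma vgeD n f g : vge n f -> vge n g -> vge n (f + g).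
Proof.
case=> [->|nf]; first by rewrite add0r.
case=> [->|ng]; first by rewrite addr0; right.
have [->|f0] := eqVneq f 0; first by rewrite add0r; right.
have [->|g0] := eqVneq g 0; first by rewrite addr0; right.
have [->|s0] := eqVneq (f + g) 0; first by left.
case: vP => _ /(_ f g f0 g0 s0) tri _ _.
by right; apply: le_trans tri; rewrite le_min nf ng.
Qed.

Lemma vge_sum n (I : Type) (r : seq I) (P : pred I) (t : I -> K) :
  (forall i, P i -> vge n (t i)) -> vge n (\sum_(i <- r | P i) t i).
Proof. by move=> h; apply: big_ind => //; [left | apply: vgeD]. Qed.

(** Summands with pairwise distinct valuations do not cancel. *)
Lemma val_sum_distinct (I : eqType) (r : seq I) (t : I -> K) : uniq r ->
  {in r &, forall i j, t i != 0 -> t j != 0 -> v (t i) = v (t j) -> i = j} ->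
  \sum_(i <- r) t i != 0 ->
  exists i, [/\ i \in r, t i != 0 & v (\sum_(i <- r) t i) = v (t i)].
Proof.
elim: r => [|i r IH]; first by rewrite big_nil eqxx.
move=> /= /andP[ir ur] inj; rewrite big_cons; set S := \sum_(_ <- r) _.
have [S0|S0] := eqVneq S 0.
  by rewrite S0 addr0 => ti; exists i; rewrite inE eqxx.
have [|j [jr tj vj]] := IH ur _ S0.
  by move=> i1 i2 h1 h2; apply: inj; rewrite inE ?h1 ?h2 orbT.
have [->|ti] := eqVneq (t i) 0.
  by rewrite add0r => _; exists j; rewrite inE jr orbT.
move=> _; case: (ltgtP (v (t i)) (v S)) => h.
- by have [_ ->] := val_min ti S0 h; exists i; rewrite inE eqxx.
- by rewrite addrC; have [_ ->] := val_min S0 ti h; exists j; rewrite inE jr orbT.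
- have e : i = j by apply: inj; rewrite ?inE ?eqxx ?jr ?orbT // h.
  by rewrite e jr in ir.
Qed.

Lemma fun_of_monomial (c : F) (i j : nat) :
  fxy (c%:P *: monoXY F i j) = iota c * x ^+ i * y ^+ j.
Proof.
by rewrite /fun_of /evalXY /monoXY scalerA map_polyZ /= rmorphM /= map_polyC
  map_polyXn /= map_polyXn hornerZ hornerXn -rmorphXn !hornerM !hornerC hornerXn.
Qed.

Hypotheses (x0 : x != 0) (y0 : y != 0).

Lemma val_monomial (c : F) (i j : nat) :
  c != 0 -> v (iota c * x ^+ i * y ^+ j) = v x *+ i + v y *+ j.
Proof.
move=> c0; rewrite !valM ?mulf_neq0 ?expf_neq0 ?fmorph_eq0 //.
by rewrite !valX // val_const // add0r.
Qed.

Lemma monomial_neq0 (c : F) (i j : nat) :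
  (iota c * x ^+ i * y ^+ j != 0) = (c != 0).
Proof. by rewrite !mulf_eq0 !negb_or !expf_neq0 // !andbT fmorph_eq0. Qed.

Lemma vge_fun_of (n : int) (p : {poly {poly F}}) :
  (forall i j : nat, p`_j`_i != 0 -> n <= v x *+ i + v y *+ j) -> vge n (fxy p).
Proof.
move=> h; rewrite (fun_of_sum (leqnn _) (max_size_coefXY p)).
apply: vge_sum => -[i j] _ /=; have [->|c0] := eqVneq p`_j`_i 0.
  by left; rewrite rmorph0 !mul0r.
by right; rewrite val_monomial // h.
Qed.

(** In an equation satisfied by x and y the least valuation is attained by at
    least two monomials. *)
Lemma no_dominant_monomial (p : {poly {poly F}}) (i0 j0 : nat) :
  fxy p = 0 -> p`_j0`_i0 != 0 ->
  (forall i j : nat, p`_j`_i != 0 -> (i, j) != (i0, j0) ->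
     v x *+ i0 + v y *+ j0 < v x *+ i + v y *+ j) -> False.
Proof.
move=> p0 c0 dom; pose u := (p`_j0`_i0)%:P *: monoXY F i0 j0.
have u0 : fxy u != 0 by rewrite fun_of_monomial monomial_neq0.
have vu : v (fxy u) = v x *+ i0 + v y *+ j0 by rewrite fun_of_monomial val_monomial.
have e : fxy u + fxy (p - u) = 0 by rewrite -rmorphD addrC subrK.
have : vge (v (fxy u) + 1) (fxy (p - u)).
  apply: vge_fun_of => i j; rewrite vu.
  rewrite !coefB /u /monoXY scalerA !coefZ coefXn.
  case: (eqVneq j j0) => [->|nj]; last first.
    rewrite mulr0 coef0 subr0 => hc; rewrite lezD1.
    by apply: dom; rewrite // xpair_eqE (negPf nj) andbF.
  rewrite mulr1 coefCM coefXn; case: (eqVneq i i0) => [->|ni].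
    by rewrite mulr1 subrr eqxx.
  rewrite mulr0 subr0 => hc; rewrite lezD1.
  by apply: dom; rewrite // xpair_eqE (negPf ni).
case=> [h|h]; first by rewrite h addr0 in e; rewrite e eqxx in u0.
have [q0|q0] := eqVneq (fxy (p - u)) 0.
  by rewrite q0 addr0 in e; rewrite e eqxx in u0.
have [|s0 _] := val_min u0 q0; first by rewrite -lezD1.
by rewrite e eqxx in s0.
Qed.

End Valuations.

(** * Pole orders of x and y *)

Lemma mulrn_int (z : int) (n : nat) : z *+ n = z * n%:Z.
Proof. by rewrite -mulr_natr natz. Qed.

(** If the weights (al, be) are tilted towards X, compared with the weights
    (a, b) for which X^b and Y^a are level, then X^b outweighs every other
    monomial on or below the line joining X^b to Y^a. *)
Lemma weight_dominated (a b i j : nat) (al be : int) :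
  (0 < a)%N -> 0 < al -> be *+ a < al *+ b -> (a * i + b * j <= a * b)%N ->
  (i, j) != (b, 0%N) -> al *+ i + be *+ j < al *+ b.
Proof.
rewrite !mulrn_int => a0 al0 lt le ne.
have a0' : 0 < a%:Z by rewrite ltz_nat.
rewrite -(ltr_pM2r a0').
have le' : al * (a%:Z * i%:Z + b%:Z * j%:Z) <= al * (a%:Z * b%:Z).
  by rewrite ler_pM2l // -!PoszM -PoszD lez_nat.
case: j le ne le' => [|j] le ne le'.
  have ib : (i < b)%N.
    rewrite ltn_neqAle -(leq_pmul2l a0) (leq_trans (leq_addr _ _) le) andbT.
    by apply: contraNneq ne => ->.
  by rewrite mulr0 addr0 ltr_pM2r // ltr_pM2l.
have : be * a%:Z * j.+1%:Z < al * b%:Z * j.+1%:Z by rewrite ltr_pM2r.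
by lra.
Qed.

(** Modulo a, the weight determines b j and hence j < a. *)
Lemma weight_inj (a b i j i' j' : nat) :
  coprime a b -> (j < a)%N -> (j' < a)%N ->
  (a * i + b * j = a * i' + b * j')%N -> i = i' /\ j = j'.
Proof.
move=> cab ja ja'; wlog le : i i' j j' ja ja' / (j <= j')%N => [hw|] e.
  case: (leqP j j') => h; first exact: hw.
  by have [|||//|-> ->] := hw i' i j' j; rewrite // ltnW.
have a0 : (0 < a)%N by apply: leq_ltn_trans ja.
suff jj : j = j' by split=> //; subst j'; apply/eqP; rewrite -(eqn_pmul2l a0); apply/eqP; lia.
have : (a %| b * (j' - j))%N.
  by apply/dvdnP; exists (i - i')%N; nia.
rewrite Gauss_dvdr // => h; have [|lt] := posnP (j' - j)%N; first by lia.
by have := dvdn_leq lt h; lia.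
Qed.

Section PoleOrders.

Variables (F : finFieldType) (K : fieldType) (iota : {rmorphism F -> K}).
Variables (x y : K) (a b : nat) (H : {poly {poly F}}) (v : K -> int).
Hypotheses (a0 : (0 < a)%N) (b0 : (0 < b)%N) (cab : coprime a b).
Hypotheses (HH : cab_poly a b H) (ff : function_field iota x y H).
Hypotheses (vP : is_place iota v) (px : pole v x) (py : pole v y).
Local Notation fxy := (fun_of iota x y).

Let x0 : x != 0 := px.1.
Let y0 : y != 0 := py.1.

Lemma fun_of_H : fxy H = 0.
Proof. by apply/(ff.1 H).2; exists 1; rewrite mul1r. Qed.

(** Otherwise x^b or y^a would dominate in H(x,y) = 0. *)
Lemma val_xy_ratio : v x *+ b = v y *+ a.
Proof.
have [[Hb Ha] Hw _] := HH; case: px => _ vx; case: py => _ vy.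
case: (ltgtP (v x *+ b) (v y *+ a)) => // lt; exfalso.
- apply: (no_dominant_monomial vP x0 y0 fun_of_H Hb) => i j /Hw le ne.
  rewrite mulr0n addr0 -ltrN2 opprD -!mulNrn.
  apply: weight_dominated le ne => //; first by rewrite oppr_gt0.
  by rewrite !mulNrn ltrN2.
- apply: (no_dominant_monomial vP x0 y0 fun_of_H Ha) => i j /Hw le ne.
  rewrite mulr0n add0r -ltrN2 opprD -!mulNrn addrC.
  apply: (@weight_dominated b a j i) => //; first by rewrite oppr_gt0.
  + by rewrite !mulNrn ltrN2.
  + by rewrite addnC [(b * a)%N]mulnC.
  + by apply: contraNneq ne => -[-> ->].
Qed.

Lemma val_xy_multiple :
  exists s : nat, v x = - (s * a)%:Z /\ v y = - (s * b)%:Z.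
Proof.
have := val_xy_ratio; case: px => _ vx; case: py => _ vy.
have -> : v x = - `|v x|%N%:Z by rewrite abszE ltr0_norm // opprK.
have -> : v y = - `|v y|%N%:Z by rewrite abszE ltr0_norm // opprK.
move: `|v x|%N `|v y|%N => al be; rewrite !mulNrn => /oppr_inj.
rewrite !mulrn_int -!PoszM => -[e].
have /dvdnP[s es] : (a %| al)%N.
  by rewrite -(Gauss_dvdl _ cab) e dvdn_mull.
exists s; rewrite es; split=> //; congr (- (_ %:Z)).
by apply/eqP; rewrite -(eqn_pmul2r a0) -e es mulnAC.
Qed.

(** Division by H, after scaling it to be monic in Y. *)
Lemma standard_form_exists (p : {poly {poly F}}) :
  exists2 r, fxy p = fxy r & (size r <= a)%N.
Proof.
have [sH lH] := cab_lead a0 b0 HH.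
have c0 : H`_a`_0 != 0 by case: HH => -[].
pose D := (H`_a`_0)^-1%:P *: H.
have sD : size D = a.+1 by rewrite size_scale ?polyC_eq0 ?invr_eq0.
have mD : D \is monic.
  by rewrite monicE lead_coefE sD /= coefZ lH -rmorphM coefC mulVf.
have D0 : fxy D = 0 by rewrite /D -mul_polyC rmorphM /= fun_of_H mulr0.
exists (Pdiv.Ring.rmodp p D).
  rewrite [in LHS](Pdiv.RingMonic.rdivp_eq mD p) rmorphD rmorphM.
  by rewrite /= D0 mulr0 add0r.
by rewrite -ltnS -sD Pdiv.Ring.ltn_rmodp -size_poly_eq0 sD.
Qed.

(** The monomials of a standard form have distinct pole orders, so all the
    valuations are multiples of s; a normalised valuation takes the value 1. *)
Lemma val_xy : v x = - a%:Z /\ v y = - b%:Z.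
Proof.
have [s [vx vy]] := val_xy_multiple.
suff s1 : s = 1%N by rewrite vx vy s1 !mul1n.
have s0 : (0 < s)%N.
  by case: px => _; rewrite vx oppr_lt0 ltz_nat muln_gt0 => /andP[].
have dv p : fxy p != 0 -> exists e : nat, v (fxy p) = - (s * e)%:Z.
  have [r -> sr] := standard_form_exists p.
  rewrite (fun_of_sum _ _ _ sr (max_size_coefXY r)).
  have vm (c : F) (i j : nat) : c != 0 ->
      v (iota c * x ^+ i * y ^+ j) = - (s * (a * i + b * j))%:Z.
    move=> c0; rewrite val_monomial // vx vy !mulrn_int; lia.
  case/(val_sum_distinct vP (index_enum_uniq _)) => [[i j] [i' j'] _ _ /=|].
    rewrite !monomial_neq0 // => c0 c0'; rewrite !vm // => /oppr_inj[/eqP].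
    rewrite eqn_pmul2l // => /eqP /(weight_inj cab (ltn_ord _) (ltn_ord _))[ei ej].
    by congr (_, _); apply: val_inj.
  move=> [i j] [_ /=]; rewrite monomial_neq0 // => c0 ->.
  by exists (a * i + b * j)%N; rewrite vm.
case: (vP) => _ _ _ [t t0 vt]; have [p [q [q0 e]]] := ff.2 t.
have p0 : fxy p != 0 by apply: contraNneq t0 => p0; rewrite e p0 mul0r.
have : v (fxy p) = v t + v (fxy q) by rewrite -(valM vP) // e divfK.
have [e1 ->] := dv p p0; have [e2 ->] := dv q q0; rewrite vt => h.
have /eqP : (s * e2 = 1 + s * e1)%N by lia.
have : (s %| 1)%N by rewrite -(dvdn_addl _ (dvdn_mulr e1 (dvdnn s))); apply/dvdnP; exists e2; lia.
by rewrite dvdn1 => /eqP.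
Qed.

End PoleOrders.

(** The codeword is the evaluation of the function varphi(msg)(x,y): with
    denominator 1, this function takes at each point the value of its lift, and
    the pole orders a and b of x and y put it in the Riemann-Roch space. *)
Lemma phi_in_code (F : finFieldType) (K : fieldType) (iota : {rmorphism F -> K})
    (x y : K) (vinf : K -> int) (a b m n k : nat) (H : {poly {poly F}})
    (P : n.-tuple (F * F)) (C : {vspace 'rV[F]_n})
    (Bhat : k.-tuple (nat * nat)) (msg : 'rV[F]_k) :
  (0 < a)%N -> (0 < b)%N -> coprime a b -> cab_poly a b H ->
  function_field iota x y H -> is_Pinf iota x y vinf ->
  is_cab_code iota x y vinf P m C -> all (in_B a b m) Bhat ->
  phi P Bhat msg \in C.
Proof.
move=> a0 b0 cab HH ff [[vP _] px py only] codeC inB.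
have x0 := px.1; have y0 := py.1.
have [vx vy] := val_xy a0 b0 cab HH ff vP px py.
apply/codeC; exists (fun_of iota x y (varphi Bhat msg)); last first.
  move=> i; exists (varphi Bhat msg), 1.
  by rewrite /evalP /evalXY !hornerC oner_neq0 rmorph1 !divr1 mxE.
have coefB i j : (varphi Bhat msg)`_j`_i != 0 -> (a * i + b * j <= m)%N.
  move=> c0; have : (i, j) \in Bhat by apply: contraNT c0 => /coef_varphi_notin->.
  by move/(allP inB) => /andP[].
move=> f0; split.
  have [|h|//] := @vge_fun_of _ _ iota x y vinf vP x0 y0 (- m%:Z) (varphi Bhat msg).
    move=> i j /coefB; rewrite vx vy !mulrn_int; lia.
  by rewrite h eqxx in f0.
move=> w wP nw.
have [wx wy] : 0 <= w x /\ 0 <= w y.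
  by split; rewrite leNgt; apply/negP => neg; apply: nw; apply: only => //; [left|right].
have [|h|//] := @vge_fun_of _ _ iota x y w wP x0 y0 0 (varphi Bhat msg).
  by move=> i j _; rewrite addr_ge0 // mulrn_wge0.
by rewrite h eqxx in f0.
Qed.

(** * Operations outside the univariate evaluations *)

Section CostBounds.

Variable F : finFieldType.

Lemma cost_mapM_le (A : Type) (B : eqType) (h : B -> prog F F (memo F) A)
    (c : nat) (s : seq B) :
  {in s, forall e, cost (h e) <= c}%N -> (cost (mapM h s) <= c * size s)%N.
Proof.
move=> hc; rewrite cost_mapM -sum1_size big_distrr /= !big_seq.
by apply: leq_sum => e es; rewrite muln1 hc.
Qed.

(** The polynomials g_alpha of the second stage matter only through the bound
    on their degrees. *)
Lemma cost_bivariate_mpe (mpe : mpe_algo F) (f : seq (seq F)) (pts : seq (F * F)) :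
  let X := undup (rev [seq Q.1 | Q <- pts]) in
  exists2 g : F -> {poly F}, forall al, (size (g al) <= size f)%N &
    (cost (@bivariate_mpe F F (memo F) mpe f pts) <=
     3 + 6 * size pts + 2 * \sum_(fj <- f) size fj + size X * (4 * size f + 2)
     + \sum_(fj <- f) cost (mpe F (memo F) (Poly fj) X)
     + \sum_(al <- X) cost (mpe F (memo F) (g al) (rev (fibre pts al))))%N.
Proof.
move=> X; rewrite /bivariate_mpe cost_bind.
have := cost_abscissae pts; have := output_abscissae pts.
move: (cost (abscissae _ _ pts)) => c0.
case: (output (abscissae _ _ pts)) => X' Y []; cbn [fst snd] => ->; rewrite -/X.
move=> hY hc0 {X'}; rewrite cost_bind; set Fs := output (mapM _ f).
have sFs : size Fs = size f by rewrite /Fs output_mapM size_map.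
pose g al := [seq odflt 0 (Fi (KElt al)) | Fi <- Fs : seq (memo F F)].
have sg al : size (g al) = size f by rewrite size_map.
exists (fun al => Poly (g al)) => [al|].
  by rewrite -(sg al) size_Poly.
rewrite cost_bind cost_bind cost_bind.
have hF : (cost (mapM (fun fi => let* fi' := trim F (memo F) fi in
      mpe F (memo F) fi' X)%prog f) <=
    2 * \sum_(fj <- f) size fj + \sum_(fj <- f) cost (mpe F (memo F) (Poly fj) X))%N.
  rewrite cost_mapM big_distrr /= -big_split /=; apply: leq_sum => fj _.
  by rewrite cost_bind output_trim leq_add2r cost_trim.
set cG := cost (foldM _ _ X); set cr := cost (foldM _ _ pts).
have hG : (cG <= size X * (4 * size f + 2)
    + \sum_(al <- X) cost (mpe F (memo F) (Poly (g al)) (rev (fibre pts al))))%N.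
  rewrite mulnC -(sum1_size X) big_distrr /= -big_split /=.
  apply: cost_foldM => G al; rewrite !cost_bind output_trim output_mapM output_lookup.
  have -> : [seq output (get F Fi (KElt al)) | Fi <- Fs] = g al.
    by apply: eq_map => Fi; rewrite output_get.
  have -> : odflt [::] (Y (KElt al)) = rev (fibre pts al).
    rewrite hY; case: ifPn => // nal; case E: (fibre pts al) => [//|be s].
    have : be \in fibre pts al by rewrite E inE eqxx.
    by rewrite mem_fibre => /(map_f fst); rewrite (negPf nal).
  have h1 : (cost (mapM (fun Fi => get F Fi (KElt al)) Fs) <= 2 * size f)%N.
    rewrite -sFs cost_mapM -sum1_size big_distrr /=.
    by apply: leq_sum => Fi _; rewrite muln1 cost_get.
  have h2 := cost_trim (g al); rewrite sg in h2.
  have -> : cost (lookup F Y (KElt al)) = 1%N by [].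
  set Ga := output (mpe _ _ _ _); have -> : cost (insert F G (KElt al) Ga) = 1%N by [].
  by apply: leq_trans (leq_add h1 (leq_add h2 (leqnn _))) _; lia.
have hr : (cr <= 4 * size pts)%N.
  rewrite -sum1_size big_distrr /=; apply: cost_foldM => r Q.
  rewrite cost_bind output_lookup.
  have -> V (t : memo F V) i : cost (lookup F t i) = 1%N by [].
  case: (_ (KElt Q.1)) => [Ga|] //; rewrite cost_bind.
  have -> V (t : memo F V) i e : cost (insert F t i e) = 1%N by [].
  by have := cost_get Ga (KElt Q.2); lia.
have -> V : cost (new_table F F (memo F) V) = 1%N by [].
apply: leq_trans (leq_add hc0 (leq_add hF (leq_add (leqnn 1)
  (leq_add hG (leq_add (leqnn 1) hr))))) _; lia.
Qed.

Lemma size_standard_form (a b m : nat) (Bhat : seq (nat * nat)) (msg : seq F) :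
  let f := output (standard_form F (memo F) a b m Bhat msg) in
  size f = minn a (m %/ b).+1 /\ {in f, forall fj, size fj <= (m %/ a).+1}%N.
Proof.
rewrite /standard_form !output_bind output_mapM size_map size_iota; split=> //.
move=> _ /mapP[j _ ->]; rewrite output_mapM size_map size_iota ltnS.
by rewrite leq_div2r ?leq_subr.
Qed.

Lemma cost_standard_form (a b m : nat) (Bhat : seq (nat * nat)) (msg : seq F) :
  (cost (standard_form F (memo F) a b m Bhat msg) <=
   1 + size Bhat + 2 * (minn a (m %/ b).+1 * (m %/ a).+1))%N.
Proof.
rewrite /standard_form cost_bind cost_bind -addnA; apply: leq_add => //.
apply: leq_add.
  apply: (@leq_trans (size (zip Bhat msg))); last by rewrite size_zip geq_minl.
  by rewrite -sum1_size; apply: cost_foldM.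
rewrite [(minn _ _ * _)%N]mulnC mulnA.
set s := iota 0 _; have -> : minn a (m %/ b).+1 = size s by rewrite size_iota.
apply: cost_mapM_le => j _.
set t := iota 0 _; apply: (@leq_trans (2 * size t)).
  by apply: cost_mapM_le => i _; apply: cost_get.
by rewrite leq_pmul2l // size_iota ltnS leq_div2r ?leq_subr.
Qed.

End CostBounds.

(** * Consequences of the regularity of M *)

Section Regularity.

Variables (R : realType) (M : nat -> R).
Hypothesis M1 : forall n, (0 < n)%N -> 1 <= M n.
Hypothesis Madd :
  forall n1 n2, (0 < n1)%N -> (0 < n2)%N -> M n1 + M n2 <= M (n1 + n2)%N.

Lemma M_ge0 (n : nat) : (0 < n)%N -> 0 <= M n.
Proof. by move=> /M1; apply: le_trans. Qed.

Lemma M_mono (n1 n2 : nat) : (0 < n1)%N -> (n1 <= n2)%N -> M n1 <= M n2.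
Proof.
move=> n0; rewrite leq_eqVlt => /orP[/eqP->//|lt].
rewrite -(subnKC (ltnW lt)); apply: le_trans (Madd n0 _); last by rewrite subn_gt0.
by rewrite lerDl M_ge0 // subn_gt0.
Qed.

Lemma M_ge_id (n : nat) : (0 < n)%N -> n%:R <= M n.
Proof.
elim: n => // -[|n] IH _; first exact: M1.
by rewrite -[in X in _ <= M X]addn1 -natr1; apply: le_trans (Madd _ _) => //; rewrite lerD ?IH ?M1.
Qed.

Lemma M_sum (A : Type) (r : seq A) (d : A -> nat) (N : nat) :
  (0 < N)%N -> (\sum_(i <- r) d i <= N)%N ->
  \sum_(i <- r | (1 < d i)%N) M (d i) <= M N.
Proof.
move=> N0 le.
(* M 0 is unconstrained, so it is replaced by 0. *)
pose W n := if n is 0 then 0 else M n.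
have Wadd n1 n2 : W n1 + W n2 <= W (n1 + n2)%N.
  case: n1 n2 => [|n1] [|n2]; rewrite ?addn0 ?addr0 ?add0r //.
  by rewrite addSn /= -addSn Madd.
have W0 n : 0 <= W n by case: n => // n; rewrite M_ge0.
apply: (@le_trans _ _ (W (\sum_(i <- r) d i)%N)); last first.
  case E: (\sum_(i <- r) d i)%N le => [|n] le; first by rewrite M_ge0.
  exact: M_mono.
elim: r {le} => [|i r IH]; first by rewrite !big_nil.
rewrite !big_cons; apply: le_trans (Wadd _ _).
case: ifP => [|_]; last by rewrite -[leLHS]add0r lerD.
by case: (d i) => // n _; rewrite lerD2l.
Qed.

(** Superadditivity of M lets a family of evaluations be charged as one
    evaluation of the total size; those of size at most one, whose cost the
    specification bounds by kappa, are counted separately. *)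
Lemma mpe_family (kappa : R) (A : eqType) (r : seq A) (d : A -> nat) (c : A -> R)
    (N : nat) :
  (0 < N)%N -> (\sum_(i <- r) d i <= N)%N ->
  {in r, forall i, c i <=
     if (d i <= 1)%N then kappa else kappa * (M (d i) * ln (d i)%:R)} ->
  \sum_(i <- r) c i <= `|kappa| * (size r)%:R + `|kappa| * (M N * ln N%:R).
Proof.
move=> N0 le hc.
have lnN : 0 <= ln N%:R :> R by rewrite ln_ge0 // ler1n.
have dN i : i \in r -> (d i <= N)%N.
  by move=> ir; apply: leq_trans le; rewrite (big_rem i) //= leq_addr.
apply: (@le_trans _ _ (\sum_(i <- r)
    (`|kappa| + (if (1 < d i)%N then `|kappa| * (M (d i) * ln N%:R) else 0)))).
  rewrite !big_seq; apply: ler_sum => i ir; apply: le_trans (hc i ir) _.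
  rewrite leqNgt; case: ltnP => /= h; last by rewrite addr0 ler_norm.
  have Md : 0 <= M (d i) by rewrite M_ge0 // ltnW.
  apply: (@le_trans _ _ (`|kappa| * (M (d i) * ln N%:R))); last by rewrite lerDr.
  apply: (@le_trans _ _ (`|kappa| * (M (d i) * ln (d i)%:R))).
    by rewrite ler_wpM2r ?ler_norm // mulr_ge0 // ln_ge0 // ler1n ltnW.
  rewrite ler_wpM2l // ler_wpM2l // ler_ln ?posrE ?ltr0n ?ler_nat ?dN //.
  exact: ltnW.
rewrite big_split /=; apply: lerD.
  by rewrite big_const_seq count_predT iter_addr_0 mulr_natr.
rewrite -big_mkcond -mulr_sumr -mulr_suml ler_wpM2l // ler_wpM2r //.
exact: M_sum.
Qed.

End Regularity.

Lemma ln_double (R : realType) (N : nat) :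
  (2 <= N)%N -> ln (2 * N)%:R <= 2 * ln N%:R :> R.
Proof.
move=> N2; have N0 : (0 < N)%N by apply: ltnW.
rewrite mulr_natl mulr2n -lnM ?posrE ?ltr0n // -natrM.
by rewrite ler_ln ?posrE ?ltr0n ?muln_gt0 ?N0 // ler_nat leq_pmul2r.
Qed.

(** * The cost of encoding *)

(** Everything outside the univariate evaluations costs at most 23 N, and
    there are at most 3 N evaluations of size at most one, each costing
    |kappa|; as N <= M(N) ln(N) / ln 2, this gives the first term of the
    constant. The larger evaluations of the two stages, of total sizes N and
    2 N, give the other two. *)
Lemma cost_encode (R : realType) (kappa : R) (F : finFieldType) (M : nat -> R)
    (mpe : mpe_algo F) (a b m n k : nat) (H : {poly {poly F}})
    (P : n.-tuple (F * F)) (Bhat : k.-tuple (nat * nat)) (msg : seq F) :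
  let N := (m + a * n_X P)%N in
  (forall n, (0 < n)%N -> 1 <= M n) ->
  (forall n1 n2, (0 < n1)%N -> (0 < n2)%N -> M n1 + M n2 <= M (n1 + n2)%N) ->
  (forall n, (0 < n)%N -> M (2 * n)%N <= kappa * M n) ->
  univariate_mpe_spec kappa M mpe ->
  (0 < a)%N -> (0 < b)%N -> cab_poly a b H ->
  uniq P -> (forall Q, Q \in P -> evalP H Q = 0) -> (k <= n)%N -> (2 <= N)%N ->
  (cost (@encode F F (memo F) mpe a b m Bhat P msg))%:R <=
  ((23 + 3 * `|kappa|) / ln 2 + (`|kappa| + 2 * `|kappa| ^+ 2)) * (M N * ln N%:R).
Proof.
move=> N M1 Madd Mdbl spec a0 b0 HH uP HP kn N2.
have N0 : (0 < N)%N by apply: ltnW.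
rewrite /encode cost_bind.
have := cost_standard_form a b m Bhat msg.
have := size_standard_form a b m Bhat msg.
move: (cost (standard_form _ _ _ _ _ _ _)) => c1.
move: (output (standard_form _ _ _ _ _ _ _)) => f [sf hf].
rewrite -sf => hc1; rewrite size_tuple in hc1; rewrite cost_bind.
have [g sg] := cost_bivariate_mpe mpe f P.
set X := undup _; have sX : size X = n_X P by apply: n_X_rev.
rewrite sX size_tuple.
move: (cost (bivariate_mpe _ _ _ _)) => c2.
set S1 := (\sum_(fj <- f) cost _)%N; set S2 := (\sum_(al <- X) _)%N => hc2.
set c3 := cost (mapM _ _).
have hc3 : (c3 <= 2 * n)%N.
  rewrite -{1}(size_tuple P); apply: cost_mapM_le => Q _; apply: cost_get.
have nN : (n <= a * n_X P)%N.
  by rewrite -{1}(size_tuple P) (size_points a0 b0 HH).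
have fa : (size f <= a)%N by rewrite sf geq_minl.
have fm : (size f <= m + 1)%N.
  by rewrite sf addn1 (leq_trans (geq_minr _ _)) // ltnS leq_div.
have fgrid : (size f * (m %/ a) <= m)%N.
  by apply: leq_trans (leq_mul fa (leqnn _)) _; rewrite mulnC leq_divM.
have fX : (size f * n_X P <= a * n_X P)%N by rewrite leq_mul.
have Xa : (n_X P <= a * n_X P)%N by rewrite leq_pmull.
have sumf : (\sum_(fj <- f) size fj <= size f * (m %/ a).+1)%N.
  rewrite mulnC -sum1_size big_distrr /= !big_seq; apply: leq_sum => fj /hf.
  by rewrite muln1.
have total : (c1 + (c2 + c3) <= 23 * N + S1 + S2)%N.
  have eX : (n_X P * (4 * size f + 2) = 4 * (size f * n_X P) + 2 * n_X P)%N by lia.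
  rewrite mulnS in hc1; rewrite mulnS in sumf; rewrite eX in hc2.
  rewrite /N in N2 *; clear -hc1 hc2 hc3 sumf N2 fa fm fgrid fX Xa nN kn.
  by move: (size f * _)%N (size f * _)%N (a * _)%N hc1 hc2 sumf fgrid fX Xa nN N2;
    lia.
have bd1 : S1%:R <= `|kappa| * (size f)%:R + `|kappa| * (M N * ln N%:R).
  rewrite natr_sum; apply: (mpe_family M1 Madd N0 (d := fun fj =>
    ((size (Poly fj)).-1 + size X)%N)).
    apply: (@leq_trans (\sum_(fj <- f) (m %/ a + n_X P))%N).
      rewrite !big_seq; apply: leq_sum => fj /hf h; rewrite sX leq_add2r.
      by rewrite -subn1 leq_subLR add1n (leq_trans (size_Poly _) h).
    rewrite big_const_seq count_predT iter_addn_0 mulnC mulnDr.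
    exact: leq_add.
  by move=> fj _; have [|_] := spec (Poly fj) X; rewrite ?undup_uniq.
have bd2 : S2%:R <= `|kappa| * (n_X P)%:R + `|kappa| * (M (2 * N)%N * ln (2 * N)%:R).
  rewrite natr_sum -sX; apply: (mpe_family M1 Madd _ (d := fun al =>
    ((size (g al)).-1 + size (rev (fibre P al)))%N)); first by rewrite muln_gt0.
    rewrite big_split /= mul2n -addnn; apply: leq_add.
      apply: (@leq_trans (\sum_(al <- X) a)%N).
        apply: leq_sum => al _; apply: leq_trans (leq_pred _) _.
        exact: leq_trans (sg al) fa.
      by rewrite big_const_seq count_predT iter_addn_0 sX leq_addl.
    under eq_bigr do rewrite size_rev.
    rewrite (sum_size_fibre (undup_uniq _)) ?size_tuple.
      exact: leq_trans nN (leq_addl _ _).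
    by move=> z; rewrite mem_undup mem_rev.
  move=> al _; have [|_] := spec (g al) (rev (fibre P al)) => //.
  by rewrite rev_uniq fibre_uniq.
have lnN : 0 <= ln N%:R :> R by rewrite ln_ge0 // ler1n.
have ln2 : 0 < ln 2 :> R by rewrite ln_gt0 // ltr1n.
have MN := M_ge_id M1 Madd N0.
have MN0 := M_ge0 M1 N0.
set K := `|kappa| in bd1 bd2 *; have K0 : 0 <= K by apply: normr_ge0.
set L := M N * ln N%:R.
have bd3 : M (2 * N)%N * ln (2 * N)%:R <= 2 * K * L.
  apply: (@le_trans _ _ ((K * M N) * (2 * ln N%:R))); last by rewrite /L; lra.
  apply: ler_pM; first by rewrite (M_ge0 M1) // muln_gt0.
  - by rewrite ln_ge0 // ler1n muln_gt0.
  - by apply: le_trans (Mdbl _ N0) _; rewrite ler_wpM2r ?ler_norm.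
  - exact: ln_double.
have NL : N%:R <= L / ln 2.
  rewrite ler_pdivlMr // /L; apply: ler_pM => //; first exact: ltW.
  by rewrite ler_ln ?posrE ?ltr0n // ler_nat.
have f2 : (size f)%:R <= 2 * N%:R :> R.
  rewrite -natrM ler_nat (leq_trans fm) // mul2n -addnn.
  by rewrite leq_add // leq_addr.
have X1 : (n_X P)%:R <= N%:R :> R by rewrite ler_nat (leq_trans Xa) ?leq_addl.
apply: (@le_trans _ _ (23 * N%:R + S1%:R + S2%:R)).
  by rewrite -natrM -!natrD ler_nat.
apply: (@le_trans _ _ (23 * N%:R + (K * (2 * N%:R) + K * L) +
   (K * N%:R + K * (2 * K * L)))).
  rewrite lerD // ?lerD //.
  - by apply: le_trans bd1 _; rewrite lerD2r ler_wpM2l.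
  - by apply: le_trans bd2 _; rewrite lerD // ler_wpM2l.
rewrite [leRHS]mulrDl mulrAC -mulrA.
have : (23 + 3 * K) * N%:R <= (23 + 3 * K) * (L / ln 2).
  by rewrite ler_wpM2l // addr_ge0 // mulr_ge0.
lra.
Qed.

(** * Soft-O bounds *)

Lemma ln_ge1 (R : realType) (n : nat) : (4 <= n)%N -> 1 <= ln n%:R :> R.
Proof.
move=> n4; apply: (@le_trans _ _ (ln 4)); last first.
  by rewrite ler_ln ?posrE ?ltr0n ?ler_nat // (leq_trans _ n4).
have : ln (1 + - 2^-1) <= - 2^-1 :> R by apply: le_ln1Dx; lra.
have -> : 1 + - 2^-1 = 2^-1 :> R by lra.
have -> : 4 = 2 * 2 :> R by lra.
rewrite lnV ?posrE // lnM ?posrE //; lra.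
Qed.

(** Three logarithmic factors are lost: two in M, as ln (ln n) <= ln n, and one
    in the multipoint evaluations. *)
Lemma bigO_softO (R : realType) (M t : nat -> R) :
  bigO M (fun n => n%:R * ln n%:R * ln (ln n%:R)) ->
  bigO t (fun N => M N * ln N%:R) -> softO t (fun N => N%:R).
Proof.
move=> [C1 [n1 h1]] [C2 [n2 h2]]; exists 3%N, (`|C2| * `|C1|), (maxn n1 (maxn n2 4)).
move=> n; rewrite !geq_max => /and3P[/h1 {}h1 /h2 {}h2 /ln_ge1 L1].
move: (L1 R) h1 h2 => {L1}; set L := ln n%:R => L1 h1 h2.
have L0 : 0 < L by apply: lt_le_trans L1.
have lL0 : 0 <= ln L by apply: ln_ge0.
have lL : ln L <= L by apply: ltW; apply: ln_sublinear.
have nL : 0 <= n%:R * L by rewrite mulr_ge0 // ltW.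
rewrite (ger0_norm (mulr_ge0 nL lL0)) in h1.
rewrite normrM (ger0_norm (ltW L0)) in h2.
rewrite [`|_ * L ^+ 3|]ger0_norm ?mulr_ge0 ?exprn_ge0 ?(ltW L0) //.
have {}h1 : `|M n| <= `|C1| * (n%:R * L * L).
  apply: le_trans h1 _; apply: le_trans (ler_wpM2r _ (ler_norm C1)) _.
    by rewrite mulr_ge0.
  by rewrite ler_wpM2l // ler_wpM2l.
apply: le_trans h2 _; apply: (@le_trans _ _ (`|C2| * (`|M n| * L))).
  by rewrite ler_wpM2r ?ler_norm // mulr_ge0 // ltW.
rewrite -mulrA ler_wpM2l // (_ : `|C1| * _ = (`|C1| * (n%:R * L * L)) * L).
  by rewrite ler_wpM2r // ltW.
by ring.
Qed.

Theorem mainTheorem3 (R : realType) :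
  (forall kappa : R, exists Cst : R,
    forall (F : finFieldType) (M : nat -> R) (mpe : mpe_algo F),
    multiplication_time kappa F M ->
    univariate_mpe_spec kappa M mpe ->
    forall (a b : nat) (H : {poly {poly F}}),
    (0 < a)%N -> (0 < b)%N -> coprime a b -> ~ (a = 1%N /\ b = 1%N) ->
    cab_poly a b H ->
    forall (K : fieldType) (iota : {rmorphism F -> K}) (x y : K)
           (vinf : K -> int),
    function_field iota x y H -> is_Pinf iota x y vinf ->
    forall (n : nat) (P : n.-tuple (F * F)) (m : nat),
    uniq P -> (forall Q, Q \in P -> evalP H Q = 0) ->
    (m + 1 <= n + 2 * cab_genus a b)%N ->
    forall (C : {vspace 'rV[F]_n}) (k : nat) (Bhat : k.-tuple (nat * nat)),
    is_cab_code iota x y vinf P m C -> \dim C = k -> is_Bhat a b m P Bhat ->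
    forall msg : 'rV[F]_k,
    let r := @encode F F (memo F) mpe a b m Bhat P (entries msg) in
    let N := (m + a * n_X P)%N in
    [/\ phi P Bhat msg \in C,
        output r = entries (phi P Bhat msg)
      & (2 <= N)%N -> (cost r)%:R <= Cst * (M N * ln N%:R)]) /\
  (forall M : nat -> R,
    bigO M (fun n => n%:R * ln n%:R * ln (ln n%:R)) ->
    forall t : nat -> R,
    bigO t (fun N => M N * ln N%:R) -> softO t (fun N => N%:R)).
Proof.
split; last by move=> M hM t; apply: bigO_softO.
move=> kappa; exists ((23 + 3 * `|kappa|) / ln 2 + (`|kappa| + 2 * `|kappa| ^+ 2)).
move=> F M mpe [_ M1 Madd Mdbl] spec a b H a0 b0 cab _ HH K iota x y vinf ff Pinf.
move=> n P m uP HP _ C k Bhat codeC _ hB msg r N.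
have [inB _] := hB; split.
- exact: phi_in_code a0 b0 cab HH ff Pinf codeC inB.
- apply: encode_correct => //; last exact: Bhat_uniq hB.
  by move=> h S uS; case: (spec h S uS).
- move=> N2; apply: (cost_encode Bhat _ M1 Madd Mdbl spec a0 b0 HH uP HP _ N2).
  exact: Bhat_size hB.
Qed.
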